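(* Given an AAPTA $\mathcal{A}=\langle Q,q_0,\delta,\omega\rangle$ over a finite alphabet $\Sigma$, one can build an AAPTA $\mathcal{A}^c$ over $\Sigma$ recognising the complement of $\mathcal{L}(\mathcal{A})$ (i.e. accepting exactly the $\Sigma$-labelled trees not in $\mathcal{L}(\mathcal{A})$), with size at most $\langle 1+|Q|\cdot(2+|\Sigma|\cdot|\delta|_B\cdot|\delta|_E\cdot(1+2^{|\delta|_E})),\ 4\cdot(1+|Q|)\cdot|\delta|_B\cdot|\delta|_E^3\cdot 4^{|\delta|_E},\ |\delta|_E+1,\ \max(|\delta|_U,1),\ |\omega|+1\rangle$.
   Context: Multisets: a multiset over a set $S$ is a map $\mu:S\to\mathbb{N}$; $\mu\sqsubseteq\mu'$ iff $\mu(s)\le\mu'(s)$ for all $s$; $(\mu\ominus\mu')(s)=\max(0,\mu(s)-\mu'(s))$; $\mathrm{supp}(\mu)=\{s:\mu(s)>0\}$; $|\mu|=\sum_s\mu(s)$. An EU-pair over $S$ is $\langle E;U\rangle$ with $E$ a finite multiset over $S$ and $U\subseteq S$; a multiset $\mu$ satisfies it if $E\sqsubseteq\mu$ and $\mathrm{supp}(\mu\ominus E)\subseteq U$. An EU-constraint over $S$ is a positive boolean formula built from $\top,\bot$, EU-pairs over $S$, $\wedge,\vee$. Markings: a marking of $S'$ by $S$ is a map $\nu:S'\to 2^S$; a unitary submarking is a map $\nu':S'\to S$ with $\nu'(s')\in\nu(s')$ for all $s'$; its image multiset is $s\mapsto|\{s':\nu'(s')=s\}|$. $\nu$ satisfies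 $\langle E;U\rangle$ if some unitary submarking has image multiset satisfying it; extended to EU-constraints ($\top$ always, $\bot$ never, $\wedge,\vee$ as usual, with possibly different submarkings for different conjuncts). Trees: a $D$-tree ($D$ finite) is a prefix-closed $t\subseteq D^*$ with root $\varepsilon$; successors of $n$ are the $n\cdot d\in t$; branches are maximal root-paths (finite or infinite). A $\Sigma$-labelled tree is $(t,l)$ with $t$ a $D$-tree for some finite $D$ and $l:t\to\Sigma$. Automata: an AAPTA (alternating EU parity tree automaton) over $\Sigma$ is $\langle Q,q_0,\delta,\omega\rangle$, $Q$ finite, $q_0\in Q$, $\delta:Q\times\Sigma\to$ EU-constraints over $Q$, $\omega:Q\to\mathbb{N}$. An execution tree over $(t,l)$ is a $(D\times Q)$-tree whose node $(d_1,q_1)\cdots(d_k,q_k)$ is labelled $(d_1\cdots d_k,q_k)$ (a node of $t$), root labelled $(\varepsilon,q_0)$, such that for each node $x$ labelled $(m,q)$ the marking $\nu_x(m\cdot d)=\{q':x\cdot(d,q')\text{ is a node}\}$ of the successors of $m$ satisfies $\delta(q,l(m))$. It is accepting if on every infinite branch the least priority seen infinitely often is even. $\mathcal{L}(\mathcal{A})$ is the set of trees with an accepting execution tree. Size: $\langle |Q|,|\delta|_B,|\delta|_E,|\delta|_U,|\omega|\rangle$ with $|\delta|_B$ the maximum size of the formulas $\delta(q,\sigma)$, $|\delta|_E$ and $|\delta|_U$ the maximum of $|E|$ and of $|U|$ over EU-pairs in $\delta$, $|\omega|$ the number of distinct priorities.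
   Formalization: In the first two size components |δ|_E is replaced by max(|δ|_E,1): if |δ|_E=0 and Σ is nonempty (e.g. one state, δ=⊤) the printed bound would force formulas of size at most 0, which is impossible; for |δ|_E≥1 the bounds are as printed. *)

(* Defs.v *)
From mathcomp Require Import all_boot.
From mathcomp Require Import finmap multiset.

Set Implicit Arguments.
Unset Strict Implicit.
Unset Printing Implicit Defensive.

Section Constraints.
Variable S : finType.
Local Open Scope mset_scope.

Definition mset_sat (E : {mset S}) (U : {set S}) (mu : {mset S}) : bool :=
  (E `<=` mu) && [forall s in finsupp (mu `\` E), s \in U].

Inductive eu_constraint : Type :=
| EUtop
| EUbot
| EUpair of {mset S} & {set S}
| EUand of eu_constraint & eu_constraint
| EUor of eu_constraint & eu_constraint.

Fixpoint eu_pairs (phi : eu_constraint) : seq ({mset S} * {set S}) :=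
  match phi with
  | EUtop | EUbot => [::]
  | EUpair E U => [:: (E, U)]
  | EUand phi1 phi2 | EUor phi1 phi2 => eu_pairs phi1 ++ eu_pairs phi2
  end.

(* Number of nodes of the syntax tree: an EU-pair is an atom of size 1, since
   the sizes of its two components are measured separately. *)
Fixpoint eu_size (phi : eu_constraint) : nat :=
  match phi with
  | EUtop | EUbot | EUpair _ _ => 1
  | EUand phi1 phi2 | EUor phi1 phi2 => (eu_size phi1 + eu_size phi2).+1
  end.

Section Markings.
Variable S' : finType.

Definition unitary_submarking (nu : S' -> {set S}) (f : S' -> S) : Prop :=
  forall s', f s' \in nu s'.

(* [codom f] lists [f s'] once for each [s' : S'], so the multiplicity of [s]
   is the number of [s'] with [f s' = s]. *)
Definition image_mset (f : S' -> S) : {mset S} := seq_mset (codom f).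

Fixpoint marking_sat (nu : S' -> {set S}) (phi : eu_constraint) : Prop :=
  match phi with
  | EUtop => True
  | EUbot => False
  | EUpair E U =>
      exists2 f, unitary_submarking nu f & mset_sat E U (image_mset f)
  | EUand phi1 phi2 => marking_sat nu phi1 /\ marking_sat nu phi2
  | EUor phi1 phi2 => marking_sat nu phi1 \/ marking_sat nu phi2
  end.

End Markings.
End Constraints.

Arguments EUtop {S}.
Arguments EUbot {S}.

Definition is_tree (D : finType) (t : pred (seq D)) : Prop :=
  t [::] /\ (forall m n : seq D, prefix m n -> t n -> t m).

(* The labelling is a total function on [seq D], but only its values on the
   nodes of the tree are ever used. *)
Record ltree (Sigma : finType) : Type := LTree {
  dir : finType;
  node : pred (seq dir);
  node_tree : is_tree node;
  label : seq dir -> Sigma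
}.

Arguments node {Sigma} l _.
Arguments label {Sigma} l _.

Record aapta (Sigma : finType) : Type := AAPTA {
  state : finType;
  init : state;
  delta : state -> Sigma -> eu_constraint state;
  priority : state -> nat
}.

Arguments priority {Sigma} a _.

Definition infinitely_often (P : nat -> Prop) : Prop :=
  forall N, exists2 n, N <= n & P n.

Section Semantics.
Variables (Sigma : finType) (A : aapta Sigma) (T : ltree Sigma).

Let D := dir T.
Let Q := state A.

(* The label of the node (d_1,q_1)...(d_k,q_k) of an execution tree is
   (d_1...d_k, q_k), and that of the root is (epsilon, q_0). *)
Definition exec_pos (x : seq (D * Q)) : seq D := unzip1 x.
Definition exec_state (x : seq (D * Q)) : Q := last (init A) (unzip2 x).

(* The successor [rcons m d] of [m] is represented by its last letter [d]. *)
Definition successor (m : seq D) : finType :=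
  {d : D | node T (rcons m d)}.

Definition exec_marking (e : pred (seq (D * Q))) (x : seq (D * Q)) :
    successor (exec_pos x) -> {set Q} :=
  fun d => [set q | e (rcons x (val d, q))].

Definition execution_tree (e : pred (seq (D * Q))) : Prop :=
  [/\ is_tree e,
      forall x, e x -> node T (exec_pos x)
    & forall x, e x ->
        marking_sat (@exec_marking e x)
          (delta (exec_state x) (label T (exec_pos x)))].

(* An infinite sequence [b] of letters stands for the branch made of its finite
   prefixes [mkseq b n]. *)
Definition infinite_branch (e : pred (seq (D * Q))) (b : nat -> D * Q) : Prop :=
  forall n, e (mkseq b n).

Definition seen_infinitely_often (b : nat -> D * Q) (p : nat) : Prop :=
  infinitely_often (fun n => priority A (exec_state (mkseq b n)) = p).

Definition accepting (e : pred (seq (D * Q))) : Prop :=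
  forall b, infinite_branch e b ->
  exists p, [/\ seen_infinitely_often b p,
                forall p', seen_infinitely_often b p' -> p <= p'
              & ~~ odd p].

Definition accepts : Prop :=
  exists2 e, execution_tree e & accepting e.

End Semantics.

Section Size.
Variables (Sigma : finType) (A : aapta Sigma).

Definition size_state : nat := #|state A|.

Definition size_deltaB : nat :=
  \max_(q : state A) \max_(a : Sigma) eu_size (delta q a).

(* This is 0 when only EU-pairs with empty [E] occur.  A bound on a formula size
   having it as a factor must then use [maxn size_deltaE 1] instead, since
   [eu_size] is always positive. *)
Definition size_deltaE : nat :=
  \max_(q : state A) \max_(a : Sigma)
    \max_(p <- eu_pairs (delta q a)) \sum_(s : state A) p.1 s.

Definition size_deltaU : nat :=
  \max_(q : state A) \max_(a : Sigma)
    \max_(p <- eu_pairs (delta q a)) #|p.2|.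

Definition size_priority : nat := size (undup (codom (priority A))).

End Size.

(* Main.v *)
(** A state [(q, G)] of the complement claims that no state of [G] accepts the
    current subtree.  Dualising a constraint swaps conjunction and disjunction,
    and at an EU-pair [<E; U>] Hall's theorem shows that a marking fails the pair
    iff one of finitely many counting conditions holds, each of which bounds the
    number of successors labelled by a whole set of states; hence the sets [G].
    An execution tree of the complement is then a winning strategy of the dual
    player in the acceptance game, and the two automata are complementary because
    parity games are positionally determined: the winning region is a nested
    fixpoint whose negation is the nested fixpoint of the dual game, and either
    fixpoint yields a strategy. *)

Require Import Defs.
From mathcomp Require Import all_boot zify.
From mathcomp Require Import finmap multiset.
From mathcomp.classical Require Import boolp.

Set Implicit Arguments.
Unset Strict Implicit.
Unset Printing Implicit Defensive.

(** * Parity games *)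

Definition limit_parity (c : nat -> nat) (b : bool) : Prop :=
  exists p, [/\ infinitely_often (fun n => c n = p),
                forall p', infinitely_often (fun n => c n = p') -> p <= p'
              & odd p = b].

Lemma infinitely_often_shift (P : nat -> Prop) m :
  infinitely_often (fun n => P (m + n)) <-> infinitely_often P.
Proof.
split=> H N.
  by have [n le_Nn Pn] := H N; exists (m + n); rewrite // (leq_trans le_Nn) ?leq_addl.
have [n le_n Pn] := H (m + N).
by exists (n - m); rewrite ?leq_subRL ?subnKC // (leq_trans _ le_n) ?leq_addr.
Qed.

Lemma limit_parity_shift m c b :
  limit_parity (fun n => c (m + n)) b <-> limit_parity c b.
Proof.
have io_shift p := infinitely_often_shift (fun n => c n = p) m.
split=> -[p [io_p min_p odd_p]]; exists p; split=> //; first exact/io_shift.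
- by move=> p' /io_shift/min_p.
- by apply/(io_shift p).
- by move=> p' /(io_shift p')/min_p.
Qed.

Lemma limit_parity_inj c b b' : limit_parity c b -> limit_parity c b' -> b = b'.
Proof.
move=> [p [io_p min_p <-]] [p' [io_p' min_p' <-]].
by congr odd; apply/eqP; rewrite eqn_leq min_p // min_p'.
Qed.

(** Raising all priorities by one exchanges the winners: this is how the complement turns odd limits
    into accepting ones. *)
Lemma limit_parity_succ c b :
  limit_parity (fun n => (c n).+1) b <-> limit_parity c (~~ b).
Proof.
split=> [] [p [io_p min_p odd_p]]; last first.
  exists p.+1; split=> [N|[|p'] io_p'|]; rewrite /= ?odd_p ?negbK //.
  - by have [n le_Nn <-] := io_p N; exists n.
  - by have [] := io_p' 0.
  - by apply: min_p => N; have [n le_Nn [<-]] := io_p' N; exists n.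
have [n0 _ Dp] := io_p 0; case: p Dp io_p min_p odd_p => // p _ io_p min_p <-.
exists p; rewrite /= negbK; split=> // [N|p' io_p'].
  by have [n le_Nn [<-]] := io_p N; exists n.
by apply: (min_p p'.+1) => N; have [n le_Nn <-] := io_p' N; exists n.
Qed.

Lemma nonincreasing_stabilizes (u : nat -> nat) :
  (forall n, u n.+1 <= u n) -> exists m, forall n, u (m + n) = u m.
Proof.
move=> u_dec.
have le_u m n : u (m + n) <= u m.
  by elim: n => [|n IHn]; rewrite ?addn0 // addnS (leq_trans (u_dec _)).
suff stab k m : u m < k -> exists m', forall n, u (m' + n) = u m'.
  exact: stab _ 0 (ltnSn _).
elim: k m => // k IHk m lt_um.
have [[n ltn]|noltn] := pselect (exists n, u (m + n) < u m).
  by apply: (IHk (m + n)); apply: leq_trans ltn _.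
exists m => n; apply/eqP; rewrite eqn_leq le_u leqNgt.
by apply/negP=> ltn; apply: noltn; exists n.
Qed.

(* A game is given by [Phi]: at [x] the player can force the next position to lie
   in [P] iff [Phi x P].  The player [b] wins the plays whose least priority seen
   infinitely often has parity [b]. *)
Section ParityGame.
Variables (X : countType) (prio : X -> nat).
Implicit Types (Y : nat -> X -> Prop) (W Z : X -> Prop) (S : X -> X -> Prop).
Implicit Types (Phi : X -> (X -> Prop) -> Prop) (b : bool).

Definition lfp (G : (X -> Prop) -> X -> Prop) (x : X) : Prop :=
  forall Z, (forall y, G Z y -> Z y) -> Z x.
Definition gfp (G : (X -> Prop) -> X -> Prop) (x : X) : Prop :=
  exists2 Z, (forall y, Z y -> G Z y) & Z x.

Definition upd Y k Z : nat -> X -> Prop := fun i => if i == k then Z else Y i.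

(* The positions from which [b] wins if every position of priority [i < k] must
   be left towards [Y i] and ends the play; [r] counts the priorities from [k] on. *)
Fixpoint winning Phi b r k Y : X -> Prop :=
  if r is r'.+1 then
    (if odd k == b then gfp else lfp)
      (fun Z => winning Phi b r' k.+1 (upd Y k Z))
  else fun x => Phi x (Y (prio x)).

Definition dual Phi : X -> (X -> Prop) -> Prop :=
  fun x P => ~ Phi x (fun y => ~ P y).

(** Complementation exchanges the pre-fixpoints of [G] with the post-fixpoints of its De Morgan
    dual. *)
Lemma lfpN G x : ~ lfp G x <-> gfp (fun Z y => ~ G (fun z => ~ Z z) y) x.
Proof.
rewrite /lfp -existsNP; split=> [[Z /not_implyP[GZ nZx]]|[Z GZ Zx]].
  exists (fun z => ~ Z z) => // y nZy; rewrite (_ : (fun z => _) = Z); last first.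
    by apply/funext=> z; rewrite notK.
  by move=> /GZ.
by exists (fun z => ~ Z z); apply/not_implyP; split=> [y GZy /GZ|]; [|rewrite notK].
Qed.

(** Induction on [r]: passing from [b] to [~~ b] flips the test on [odd k], so each [gfp] faces an
    [lfp] and [lfpN] applies at every level. *)
Lemma winning_dual Phi b r k Y x :
  winning (dual Phi) (~~ b) r k (fun i x => ~ Y i x) x <->
  ~ winning Phi b r k Y x.
Proof.
elim: r k Y x => [|r IHr] k Y x /=.
  rewrite /dual; suff -> : (fun y => ~ ~ Y (prio x) y) = Y (prio x) by [].
  by apply/funext=> y; rewrite notK.
have updN Z : upd (fun i x => ~ Y i x) k (fun z => ~ Z z) =
              (fun i x => ~ upd Y k Z i x).
  by apply/funext=> i; rewrite /upd; case: eqP.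
have NN Z : (fun z => ~ ~ Z z) = Z by apply/funext=> y; rewrite notK.
have -> : (odd k == ~~ b) = ~~ (odd k == b) by case: odd; case: b {IHr}.
have IHrN Z y : winning (dual Phi) (~~ b) r k.+1 (upd (fun i x => ~ Y i x) k Z) y
              = ~ winning Phi b r k.+1 (upd Y k (fun z => ~ Z z)) y.
  by apply/propext; rewrite -(IHr _ _ y) -updN NN.
case: (odd k == b) => /=; last first.
  rewrite lfpN; suff <- : (fun Z : X -> Prop =>
      winning (dual Phi) (~~ b) r k.+1 (upd (fun i x => ~ Y i x) k Z))
    = (fun Z y => ~ winning Phi b r k.+1 (upd Y k (fun z => ~ Z z)) y) by [].
  by apply/funext=> Z; apply/funext=> y.
rewrite -(notK (lfp _ _)); apply/iff_not2; rewrite lfpN.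
suff -> : (fun Z y => ~ winning (dual Phi) (~~ b) r k.+1
                          (upd (fun i x => ~ Y i x) k (fun z => ~ Z z)) y)
  = (fun Z => winning Phi b r k.+1 (upd Y k Z)) by [].
by apply/funext=> Z; apply/funext=> y; rewrite IHrN notK NN.
Qed.

(** [S] is a positional strategy on the region [W], given as a relation: [S y] is the set into which
    the next position is forced from [y]. Positions of priority below [k] are left towards [Y];
    plays that meet none are won by [b]. *)
Definition good_strategy Phi b k Y W S : Prop :=
  [/\ forall y, W y -> Phi y (S y),
      forall y z, W y -> S y z -> if prio y < k then Y (prio y) z else W z
    & forall c : nat -> X, W (c 0) -> (forall n, S (c n) (c n.+1)) ->
        (forall n, k <= prio (c n)) -> limit_parity (fun n => prio (c n)) b].

(* At [z] play the winning strategy of least index whose region contains [z]: this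
   index never increases along a play, so a single strategy is followed in the end. *)
Lemma glue_good Phi b k Y :
  exists W S, good_strategy Phi b k Y W S /\
    forall W' S' x, good_strategy Phi b k Y W' S' -> W' x -> W x.
Proof.
pose P x (WS : (X -> Prop) * (X -> X -> Prop)) :=
  good_strategy Phi b k Y WS.1 WS.2 /\ WS.1 x.
pose W x := exists WS, P x WS.
have [F FP] : {F & forall x, W x -> P x (F x)}.
  apply: (@choice _ _ (fun x WS => W x -> P x WS)) => x.
  have [[WS PxWS]|nW] := pselect (W x); first by exists WS.
  by exists (fun _ => False, fun _ _ => False) => /nW.
pose idx z n := exists x, [/\ choice.unpickle n = Some x, W x & (F x).1 z].
have idxW z : W z -> exists n, `[< idx z n >].
  move=> Wz; exists (choice.pickle z); apply/asboolP; exists z; split=> //.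
    exact: choice.pickleK.
  by have [] := FP z Wz.
have [m mP] : {m & forall z, W z -> idx z (m z) /\ forall n, idx z n -> m z <= n}.
  apply: (@choice _ _ (fun z i => W z -> idx z i /\ forall n, idx z n -> i <= n)) => z.
  have [Wz|nW] := pselect (W z); last by exists 0 => /nW.
  have [n /asboolP nP min_n] := ex_minnP (idxW z Wz).
  by exists n; split=> // n' /asboolP; apply: min_n.
pose S z y := exists x, choice.unpickle (m z) = Some x /\ (F x).2 z y.
have goodF x : W x -> good_strategy Phi b k Y (F x).1 (F x).2.
  by move=> /FP[].
exists W, S; split; last by move=> W' S' x gW' W'x; exists (W', S').
have stepW z y : W z -> S z y -> k <= prio z -> W y /\ m y <= m z.
  move=> Wz [x [mz Szy]] kz; have [[x' []]] := mP z Wz.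
  rewrite mz => -[<-] Wx Fxz _; have [_ + _] := goodF x Wx.
  move=> /(_ z y Fxz Szy); rewrite ltnNge kz /= => Fxy.
  have Wy : W y by exists (F x); split=> //; apply: goodF.
  by split=> //; have [_] := mP y Wy; apply; exists x.
split=> [z Wz|z y Wz Szy|c Wc Sc kc].
- have [[x [mz Wx Fxz]] _] := mP z Wz; have [+ _ _] := goodF x Wx.
  move=> /(_ z Fxz); suff -> : S z = (F x).2 z by [].
  apply/funext=> y; apply/propext; split=> [[x' []]|Fy]; last by exists x.
  by rewrite mz => -[<-].
- case: ltnP => [lt_zk|kz]; last by have [] := stepW z y Wz Szy kz.
  have [[x [mz Wx Fxz]] _] := mP z Wz; have [_ + _] := goodF x Wx.
  move: Szy => [x' []]; rewrite mz => -[<-] Szy /(_ z y Fxz Szy).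
  by rewrite lt_zk.
have Wcn n : W (c n) by elim: n => // n /stepW-/(_ _ (Sc n) (kc n))[].
have [N stabN] : exists N, forall n, m (c (N + n)) = m (c N).
  apply: (@nonincreasing_stabilizes (fun n => m (c n))) => n.
  by have [] := stepW _ _ (Wcn n) (Sc n) (kc n).
apply/(@limit_parity_shift N).
have [[x [mz Wx Fxz]] _] := mP _ (Wcn N); have [_ _] := goodF x Wx.
apply=> [|n|n]; rewrite ?addn0 //.
by have [x' []] := Sc (N + n); rewrite stabN mz addnS => -[<-].
Qed.

(** Induction on [r]. For [gfp], the strategy for the exits [upd Y k Z] already works. For [lfp],
    the largest good region [W] is shown to be a pre-fixpoint, by playing its own strategy inside it
    and the one for the exits [upd Y k W] outside. *)
Lemma winning_good Phi b r k Y :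
  (forall x, prio x < k + r) ->
  exists W S, good_strategy Phi b k Y W S /\
    forall x, winning Phi b r k Y x -> W x.
Proof.
elim: r k Y => [|r IHr] k Y ltk /=.
  exists (fun x => Phi x (Y (prio x))), (fun x => Y (prio x)); split=> //.
  split=> // [y z _|c _ _ /(_ 0)]; first by have := ltk y; rewrite addn0 => ->.
  by have := ltk (c 0); rewrite addn0 ltnNge => /negP.
have {}IHr Z : exists W S, good_strategy Phi b k.+1 (upd Y k Z) W S /\
    forall x, winning Phi b r k.+1 (upd Y k Z) x -> W x.
  by apply: IHr => x; rewrite addSnnS.
have [W [S [gWS maxW]]] := glue_good Phi b k Y.
case: eqP => [odd_k|/eqP odd_k]; exists W, S; split=> // x.
  move=> [Z ZZ Zx]; have [W1 [S1 [gWS1 subW1]]] := IHr Z.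
  apply: (maxW W1 S1); last exact/subW1/ZZ.
  have stepW1 y z : W1 y -> S1 y z -> if prio y < k then Y (prio y) z else W1 z.
    move=> Wy Sz; have [_ + _] := gWS1 => /(_ y z Wy Sz); rewrite ltnS /upd.
    by case: (ltngtP (prio y) k) => // _ /ZZ/subW1.
  split=> //; first by case: gWS1.
  move=> c Wc Sc kc; have Wcn n : W1 (c n).
    by elim: n => // n /stepW1/(_ (Sc n)); rewrite ltnNge kc.
  (* Either [k], of parity [b] and minimal on this play, recurs forever, or from some point on all
     priorities exceed [k]. *)
  have [io_k|/existsNP[N noN]] := pselect (infinitely_often (fun n => prio (c n) = k)).
    by exists k; split=> // p' io_p'; have [n _ <-] := io_p' 0.
  apply/(@limit_parity_shift N); case: gWS1 => _ _; apply=> [|n|n] //.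
    by rewrite addnS.
  rewrite ltn_neqAle kc andbT; apply/eqP=> Dk.
  by apply: noN; exists (N + n); rewrite ?leq_addr.
apply; have [W1 [S1 [gWS1 subW1]]] := IHr W.
move=> y Gy; pose W2 z := W z \/ W1 z.
pose S2 z := if pselect (W z) is left _ then S z else S1 z.
apply: (maxW W2 S2); last by right; apply: subW1.
have stepW2 z t : W2 z -> S2 z t -> if prio z < k then Y (prio z) t else W2 t.
  rewrite /S2; case: pselect => [Wz _|nWz [//|W1z]] St.
    by have [_ + _] := gWS => /(_ z t Wz St); case: ifP => // _; left.
  have [_ + _] := gWS1 => /(_ z t W1z St); rewrite ltnS /upd.
  by case: (ltngtP (prio z) k) => // _; [right|left].
split=> // [z|c Wc Sc kc].
  rewrite /S2; case: pselect => [Wz _|nWz [//|W1z]]; first by case: gWS => + _ _; apply.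
  by case: gWS1 => + _ _; apply.
have Wcn n : W2 (c n).
  by elim: n => // n /stepW2/(_ (Sc n)); rewrite ltnNge kc.
(* A play that enters [W] stays there; one that never does meets no priority [k], since such
   positions are left towards [W]. *)
have [[N WcN]|noW] := pselect (exists N, W (c N)).
  have WcNn n : W (c (N + n)).
    elim: n => [|n IHn]; rewrite ?addn0 // addnS.
    have := Sc (N + n); rewrite /S2; case: pselect => // _.
    by case: gWS => _ + _ => /[apply]/(_ IHn); rewrite ltnNge kc.
  apply/(@limit_parity_shift N); case: gWS => _ _; apply=> [|n|n] //.
    by rewrite addnS; have := Sc (N + n); rewrite /S2; case: pselect.
have nW n : ~ W (c n) by move=> Wn; apply: noW; exists n.
have S1c n : S1 (c n) (c n.+1).
  by have := Sc n; rewrite /S2; case: pselect => // /nW.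
have W1c n : W1 (c n) by case: (Wcn n) => // /nW.
case: (gWS1) => _ stepW1 pathW1; apply: pathW1 => // n.
rewrite ltn_neqAle kc andbT; apply/eqP => Dk.
by have := stepW1 _ _ (W1c n) (S1c n); rewrite -Dk ltnSn /upd eqxx => /nW.
Qed.

Lemma determinacy Phi r (x : X) : (forall x, prio x < r) ->
  exists W S,
    good_strategy Phi false 0 (fun _ _ => False) W S /\ W x \/
    good_strategy (dual Phi) true 0 (fun _ _ => ~ False) W S /\ W x.
Proof.
move=> ltr; have [win|] := pselect (winning Phi false r 0 (fun _ _ => False) x).
  have [W [S [gW /(_ x win)]]] := winning_good Phi false (fun _ _ => False) (k := 0) ltr.
  by exists W, S; left.
move/winning_dual => win.
have [W [S [gW /(_ x win)]]] := winning_good (dual Phi) true (fun _ _ => ~ False) (k := 0) ltr.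
by exists W, S; right.
Qed.
End ParityGame.

(** * Hall's theorem *)

Section Hall.
Variables (A B : finType).
Implicit Types (N : A -> {set B}) (X Y : {set A}).

Let nbh N X : {set B} := \bigcup_(a in X) N a.

Definition hall_condition N := forall X, #|X| <= #|nbh N X|.

Let drop N a b : A -> {set B} := fun c => if c == a then N a :\ b else N c.

(* If [X] and [Y] violated the two conditions, submodularity of [#|nbh N _|] on
   their union and intersection would contradict the condition for [N]. *)
Lemma hall_drop N a x y :
  hall_condition N -> x \in N a -> y \in N a -> x != y ->
  hall_condition (drop N a x) \/ hall_condition (drop N a y).
Proof.
move=> hallN Nx Ny neq_xy.
have [|/existsNP[X badX]] := pselect (hall_condition (drop N a x)); first by left.
have [|/existsNP[Y badY]] := pselect (hall_condition (drop N a y)); first by right.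
have drop_notin (Z : {set A}) b : a \notin Z -> nbh (drop N a b) Z = nbh N Z.
  move=> aZ; apply: eq_bigr => c cZ; rewrite /drop.
  by case: eqP => // Dc; rewrite -Dc cZ in aZ.
have drop_in (Z : {set A}) b :
    a \in Z -> nbh (drop N a b) Z = (N a :\ b) :|: nbh N (Z :\ a).
  move=> aZ; rewrite /nbh (big_setD1 a) //= /drop eqxx; congr (_ :|: _).
  by apply: eq_bigr => c; rewrite !inE => /andP[/negPf->].
(* [drop] alters the neighbours of [a] only, so a set violating the condition contains [a]. *)
have aX : a \in X by apply: contra_notT badX => aX; rewrite drop_notin.
have aY : a \in Y by apply: contra_notT badY => aY; rewrite drop_notin.
move: badX badY; rewrite !drop_in // => /negP + /negP; rewrite -!ltnNge.
set P := _ :|: _; set Q := _ :|: _ => ltX ltY.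
(* [P] omits only [x] from [N a] and [Q] only [y], so their union loses neither. *)
have subU : nbh N (X :|: Y) \subset P :|: Q.
  apply/bigcupsP=> c; rewrite inE => Xc; have [->|neq_ca] := eqVneq c a.
    apply/subsetP=> z Nz; rewrite !inE Nz !andbT.
    by case: eqP => //= ->; rewrite neq_xy /= !orbT.
  case/orP: Xc => cZ.
    apply: subset_trans (subsetUl _ _); apply: subset_trans (subsetUr _ _).
    by apply: (bigcup_max c); rewrite // !inE neq_ca.
  apply: subset_trans (subsetUr _ _); apply: subset_trans (subsetUr _ _).
  by apply: (bigcup_max c); rewrite // !inE neq_ca.
have subI : nbh N ((X :&: Y) :\ a) \subset P :&: Q.
  apply/bigcupsP=> c; rewrite !inE => /and3P[neq_ca cX cY]; rewrite subsetI.
  by apply/andP; split; apply: subset_trans (subsetUr _ _);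
     apply: (bigcup_max c); rewrite // !inE neq_ca.
(* The left sides add up to [#|X| + #|Y| - 1], but [ltX] and [ltY] bound the right sides by
   [#|X| + #|Y| - 2]. *)
have := leq_add (leq_trans (hallN _) (subset_leq_card subU))
                (leq_trans (hallN _) (subset_leq_card subI)).
rewrite cardsUI -ltnS -addnS.
have -> : #|(X :&: Y) :\ a|.+1 = #|X :&: Y| by rewrite [RHS](cardsD1 a) inE aX aY.
rewrite cardsUI => le_XY; have := leq_add ltX ltY.
by rewrite addSn addnS => /leq_trans/(_ le_XY); rewrite ltnn.
Qed.

Theorem hall_marriage N :
  hall_condition N -> exists2 f : A -> B, injective f & forall a, f a \in N a.
Proof.
have [k] := ubnP (\sum_a #|N a|); elim: k N => // k IHk N ltk hallN.
have [/existsP[a /card_gt1P[x [y [Nx Ny neq_xy]]]]|] := boolP [exists a, 1 < #|N a|].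
  have shrink b : b \in N a -> hall_condition (drop N a b) ->
      exists2 f : A -> B, injective f & forall a, f a \in N a.
    move=> Nb /IHk[|f inj_f Nf].
      rewrite -ltnS (leq_trans _ ltk) // ltnS (bigD1 a) //= [X in _ < X](bigD1 a) //=.
      rewrite -addSn leq_add //; first by rewrite /drop eqxx [X in _ < X](cardsD1 b) Nb.
      by apply: leq_sum => c /negPf; rewrite /drop => ->.
    exists f => // c; move: (Nf c); rewrite /drop.
    by case: eqP => // ->; rewrite inE => /andP[].
  by case: (hall_drop hallN Nx Ny neq_xy) => /shrink; apply.
rewrite negb_exists => /forallP leN.
have N1 a : exists b, N a = [set b].
  apply/cards1P; rewrite eqn_leq leqNgt leN /=.
  by have := hallN [set a]; rewrite cards1 /nbh big_set1.
have [f Df] := choice N1; exists f => [a c eq_f|a]; last by rewrite Df inE.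
apply/eqP; apply: contraT => neq_ac; have := hallN [set a; c].
by rewrite cards2 neq_ac /nbh bigcup_setU !big_set1 !Df eq_f setUid cards1.
Qed.
End Hall.

(** * Hall's condition for EU-pairs *)

Lemma card_ord_nth (T : Type) (x0 : T) (w : seq T) n (p : pred T) :
  size w = n -> #|[set i : 'I_n | p (nth x0 w i)]| = count p w.
Proof.
move=> <-; rewrite cardsE -sum1_card -[w in RHS](mkseq_nth x0) /mkseq count_map.
rewrite -sum1_count -[in RHS](subn0 (size w)) -[iota 0 _]/(index_iota 0 _).
by rewrite big_mkord.
Qed.

Lemma count_sum_mem (T : finType) (s : seq T) (p : pred T) :
  count p s = \sum_(x | p x) count_mem x s.
Proof.
elim: s => [|y s IHs] /=; first by rewrite big1.
rewrite big_split /= -IHs; congr (_ + _).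
have [py|npy] := boolP (p y).
  by rewrite (bigD1 y) //= eqxx big1 // => x /andP[_ /negPf]; rewrite eq_sym => ->.
by rewrite big1 // => x px; case: eqP => // Dy; rewrite Dy px in npy.
Qed.

Section Multisets.
Variable S : finType.
Local Open Scope mset_scope.
Implicit Types (E mu : {mset S}) (U F : {set S}).

Definition msupp E : {set S} := [set s | s \in E].
Definition msum E F : nat := \sum_(s in F) E s.

Lemma mset_satP E U mu :
  reflect (forall s, E s <= mu s /\ (s \notin U -> mu s <= E s))
          (mset_sat E U mu).
Proof.
apply: (iffP andP) => [[/msubsetP le_E /forall_inP subU] s|H].
  split=> // /negP notU; rewrite leqNgt; apply/negP => lt_E.
  by apply: notU; apply: subU; rewrite msuppE in_msetB.
split; first by apply/msubsetP => s; case: (H s).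
apply/forall_inP=> s; rewrite msuppE in_msetB => lt_E.
by apply: contraLR lt_E => /(proj2 (H s)); rewrite leqNgt.
Qed.

Lemma image_msetE (S' : finType) (f : S' -> S) s :
  image_mset f s = #|[set d | f d == s]|.
Proof.
rewrite mset_seqE count_map -sum1_count big_enum_cond /= -sum1dep_card.
exact: eq_bigl.
Qed.

Lemma sum_image_mset (S' : finType) (f : S' -> S) F :
  \sum_(s in F) image_mset f s = #|[set d | f d \in F]|.
Proof.
under eq_bigr do rewrite image_msetE -sum1dep_card.
rewrite -sum1dep_card [RHS](partition_big f (mem F)) //=.
by apply: eq_bigr => s sF; apply: eq_bigl => d; case: eqP => [->|]; rewrite ?sF ?andbF.
Qed.

Lemma sum_eq_msum E F : msum E F = count [in F] E.
Proof. by rewrite count_sum_mem; apply: eq_bigr => s _; rewrite count_mem_mset. Qed.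

Lemma marking_sat_mono (S' : finType) (nu nu' : S' -> {set S}) phi :
  (forall d, nu d \subset nu' d) -> marking_sat nu phi -> marking_sat nu' phi.
Proof.
move=> sub; elim: phi => //= [E U [f nuf]|phi1 IH1 phi2 IH2 []|phi1 IH1 phi2 IH2 []].
- by exists f => // d; apply: (subsetP (sub d)).
- by move=> /IH1 ? /IH2.
- by move=> /IH1; left.
- by move=> /IH2; right.
Qed.

(* Hall's theorem is applied to the successors and to the elements of [E]
   padded with wildcards, which stand for the elements of [U], up to the number
   of successors: the matching found is then a bijection and uses all of [E]. *)
Lemma hall_pair_sat (S' : finType) (nu : S' -> {set S}) E U :
  (forall F, F \subset msupp E ->
     msum E F <= #|[set d | ~~ [disjoint F & nu d]]|) ->
  (forall F, F \subset msupp E ->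
     #|[set d | [disjoint U :|: F & nu d]]| <= msum E (~: F)) ->
  marking_sat nu (EUpair E U).
Proof.
move=> hallE hallU; pose N := #|S'|.
have sizeE : size E = msum E (msupp E).
  rewrite sum_eq_msum -[LHS]count_predT; apply: eq_in_count => s sE.
  by rewrite /= inE.
have leEN : size E <= N by rewrite sizeE (leq_trans (hallE _ _)) ?max_card.
pose w : seq (option S) := map Some E ++ nseq (N - size E) None.
have szw : size w = N by rewrite size_cat size_map size_nseq subnKC.
pose lab (i : 'I_N) := nth None w i.
pose wild d := ~~ [disjoint U & nu d].
pose nb d := [set i | if lab i is Some s then s \in nu d else wild d].
have labE i s : lab i = Some s -> s \in E.
  move=> Di; have: lab i \in w by rewrite mem_nth // szw.
  rewrite Di mem_cat => /orP[/mapP[s' sE [->]] //|/nseqP[]//].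
have cardlab F : #|[set i | if lab i is Some s then s \in F else false]| = msum E F.
  rewrite (card_ord_nth None (fun o => if o is Some s then s \in F else false) szw).
  by rewrite count_cat count_map count_nseq /= mul0n addn0 sum_eq_msum.
have hall : hall_condition nb.
  move=> X; set nX := \bigcup_(a in X) _.
  pose F := [set s in msupp E | [forall d in X, s \notin nu d]].
  have subF : F \subset msupp E by apply/subsetP=> s; rewrite inE => /andP[].
  have disF d : d \in X -> [disjoint F & nu d].
    move=> Xd; rewrite disjoint_subset; apply/subsetP=> s; rewrite !inE.
    by case/andP=> _ /forall_inP/(_ d Xd).
  have inX i s : lab i = Some s -> s \notin F -> i \in nX.
    move=> Di; rewrite !inE (labE i) //= negb_forall_in => /exists_inP[d Xd].
    by rewrite negbK => nud; apply/bigcupP; exists d; rewrite // inE Di.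
  (* If [X] reaches the wildcards, only labels in [F] lie outside [nX], and [hallE] bounds their
     number by that of the successors outside [X]. *)
  have [/exists_inP[d0 Xd0 wild0]|] := boolP [exists d in X, wild d].
    rewrite -(leq_add2r #|~: nX|) cardsC card_ord.
    apply: leq_trans (_ : #|X| + msum E F <= _).
      rewrite leq_add2l -cardlab; apply/subset_leq_card/subsetP=> i.
      rewrite !inE; case Di: (lab i) => [s|]; first exact: contraR (inX i s Di).
      by case/bigcupP; exists d0; rewrite // inE Di.
    rewrite -[N](cardsC X) leq_add2l (leq_trans (hallE F subF)) //.
    apply/subset_leq_card/subsetP=> d; rewrite !inE.
    by apply: contra => /disF.
  rewrite negb_exists_in => /forall_inP nowild.
  (* Here no successor in [X] meets [U :|: F], so [hallU] bounds [#|X|] by the number of labels from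
     [E] outside [F], all of which lie in [nX]. *)
  apply: leq_trans (_ : msum E (~: F) <= _).
    apply: leq_trans (hallU F subF); apply/subset_leq_card/subsetP=> d Xd.
    rewrite inE -setI_eq0 setIUl setU_eq0 !setI_eq0 disF // andbT.
    by have := nowild d Xd; rewrite negbK.
  rewrite -cardlab; apply/subset_leq_card/subsetP=> i; rewrite !inE.
  by case Di: (lab i) => [s|] //; rewrite inE; apply: inX.
have [f inj_f nbf] := hall_marriage hall.
have [g fK gK] : bijective f by apply: inj_card_bij; rewrite // card_ord.
have [h hP] : {h & forall d, h d \in nu d /\
    (lab (f d) = Some (h d) \/ lab (f d) = None /\ h d \in U)}.
  apply: (@choice _ _ (fun d s => s \in nu d /\
    (lab (f d) = Some s \/ lab (f d) = None /\ s \in U))) => d.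
  have := nbf d; rewrite inE; case: (lab (f d)) => [s nus|].
    by exists s; split=> //; left.
  rewrite /wild disjoint_subset => /subsetPn[s Us]; rewrite !inE negbK => nus.
  by exists s; split=> //; right.
exists h => [d|]; first by case: (hP d).
apply/mset_satP => s.
have -> : E s = #|[set d | lab (f d) == Some s]|.
  rewrite -(card_imset _ inj_f) (_ : E s = msum E [set s]); last first.
    by rewrite /msum big_set1.
  rewrite -cardlab.
  congr #|pred_of_set _|; apply/setP=> i; rewrite !inE; apply/idP/imsetP.
    case Di: (lab i) => [s'|] //; rewrite inE => /eqP<-.
    by exists (g i); rewrite ?inE gK ?Di.
  by case=> d; rewrite inE => /eqP Dd ->; rewrite Dd inE.
rewrite image_msetE; split=> [|notU]; apply/subset_leq_card/subsetP=> d; rewrite !inE.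
  by move=> /eqP Dd; case: (hP d) => _; rewrite Dd => -[[->]|[]].
by move=> /eqP Dd; case: (hP d) => _; rewrite Dd (negPf notU) => -[->|[]].
Qed.

(** Both kinds of disjunct of [dual_pair] have this shape; the submarking sends [A] to [r1] and the
    rest to [r2]. *)
Lemma two_state_sat (S' : finType) (nu : S' -> {set S}) (A : {set S'}) r1 r2 :
  (forall d, d \in A -> r1 \in nu d) -> (forall d, d \notin A -> r2 \in nu d) ->
  marking_sat nu (EUpair (msetn #|A| r1) [set r2]).
Proof.
move=> nu1 nu2; exists (fun d => if d \in A then r1 else r2) => [d|].
  by case: ifPn => [/nu1|/nu2].
apply/mset_satP=> s; rewrite inE image_msetE msetnE.
case: (eqVneq s r1) => [->|neq_s]; split=> //.
- by apply/subset_leq_card/subsetP=> d Ad; rewrite inE Ad.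
- move=> neq_r; apply/subset_leq_card/subsetP=> d; rewrite inE.
  by case: ifP => // _ /eqP Dr; rewrite Dr eqxx in neq_r.
- move=> neq_r; rewrite (_ : [set _ | _] = set0) ?cards0 //.
  apply/setP=> d; rewrite !inE; apply/negbTE.
  by case: ifP => _; rewrite eq_sym.
Qed.

End Multisets.

(** * Dual constraints *)

Section Connectives.
Variables (S : finType).

Definition EUors : seq (eu_constraint S) -> eu_constraint S := foldr (@EUor S) EUbot.
Definition EUands : seq (eu_constraint S) -> eu_constraint S := foldr (@EUand S) EUtop.

Lemma marking_sat_ors (I : eqType) (r : seq I) (phi : I -> eu_constraint S)
    (S' : finType) (nu : S' -> {set S}) :
  marking_sat nu (EUors (map phi r)) <-> exists2 i, i \in r & marking_sat nu (phi i).
Proof.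
elim: r => [|i r IHr] /=; first by split=> // -[].
rewrite IHr; split=> [[sat|[j rj sat]]|[j]].
- by exists i; rewrite ?mem_head.
- by exists j; rewrite // inE rj orbT.
- by rewrite inE => /orP[/eqP->|rj]; [left|right; exists j].
Qed.

Lemma marking_sat_ands (I : eqType) (r : seq I) (phi : I -> eu_constraint S)
    (S' : finType) (nu : S' -> {set S}) :
  marking_sat nu (EUands (map phi r)) <-> forall i, i \in r -> marking_sat nu (phi i).
Proof.
elim: r => [|i r IHr] /=; first by split.
rewrite IHr; split=> [[sati sat] j|sat].
  by rewrite inE => /orP[/eqP->|/sat].
by split=> [|j rj]; apply: sat; rewrite inE ?eqxx ?rj ?orbT.
Qed.

Lemma eu_size_fold (op : eu_constraint S -> eu_constraint S -> eu_constraint S) e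
    (I : Type) (r : seq I) (phi : I -> eu_constraint S) m :
  (forall f g, eu_size (op f g) = (eu_size f + eu_size g).+1) -> eu_size e = 1 ->
  (forall i, eu_size (phi i) <= m) ->
  eu_size (foldr op e (map phi r)) <= size r * m.+1 + 1.
Proof.
move=> size_op size_e le_m; elim: r => [|i r IHr] /=; first by rewrite size_e.
by rewrite size_op -addSn mulSn -addnA leq_add // ltnS.
Qed.

Lemma eu_pairs_fold (op : eu_constraint S -> eu_constraint S -> eu_constraint S) e
    (r : seq (eu_constraint S)) :
  (forall f g, eu_pairs (op f g) = eu_pairs f ++ eu_pairs g) -> eu_pairs e = [::] ->
  eu_pairs (foldr op e r) = flatten (map (@eu_pairs S) r).
Proof.
by move=> pairs_op pairs_e; elim: r => //= phi r IHr; rewrite pairs_op IHr.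
Qed.

Lemma size_eu_pairs (phi : eu_constraint S) : size (eu_pairs phi) <= eu_size phi.
Proof.
elim: phi => //= phi1 IH1 phi2 IH2; rewrite size_cat;
  exact: leq_trans (leq_add IH1 IH2) (leqnSn _).
Qed.

End Connectives.

Section DualConstraint.
Variables (S R : finType) (tgt : {set S} -> R).
Local Open Scope mset_scope.
Implicit Types (E : {mset S}) (U F : {set S}) (phi : eu_constraint S).

(* A state [tgt F] asserts all the states of [F] at once, so [tgt set0] asserts
   nothing.  By Hall's theorem the dual of [<E; U>] says that, for some [F], either
   fewer than [|E|_F|] successors are not labelled by all of [F], or more than
   [|E|_(~: F)|] successors are labelled by all of [U :|: F]. *)
Definition dual_few E F j : eu_constraint R :=
  EUpair (msetn j (tgt set0)) [set tgt F].
Definition dual_many E U F : eu_constraint R :=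
  EUpair (msetn (msum E (~: F)).+1 (tgt (U :|: F))) [set tgt set0].
(** [dual_few] prescribes [j] copies of [tgt set0] and allows only [tgt F] besides, so a count below
    [msum E F] takes one disjunct for each [j]. *)
Definition few_range E : seq ({set S} * nat) :=
  [seq (F, j) | F <- enum (powerset (msupp E)), j <- iota 0 (msum E F)].

Definition dual_pair E U : eu_constraint R :=
  EUor (EUors [seq dual_few E x.1 x.2 | x <- few_range E])
       (EUors [seq dual_many E U F | F <- enum (powerset (msupp E))]).

Fixpoint dual_constraint phi : eu_constraint R :=
  match phi with
  | EUtop => EUbot
  | EUbot => EUtop
  | EUpair E U => dual_pair E U
  | EUand phi1 phi2 => EUor (dual_constraint phi1) (dual_constraint phi2)
  | EUor phi1 phi2 => EUand (dual_constraint phi1) (dual_constraint phi2)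
  end.

(** The first family omits the empty set, which [state_targets] lists once for each state. *)
Definition pair_targets (p : {mset S} * {set S}) : seq {set S} :=
  [seq F <- enum (powerset (msupp p.1)) | F != set0] ++
  [seq p.2 :|: F | F <- enum (powerset (msupp p.1))].

Definition targets phi : seq {set S} := flatten (map pair_targets (eu_pairs phi)).

Lemma few_rangeP E F j :
  (F, j) \in few_range E = (F \subset msupp E) && (j < msum E F).
Proof.
apply/allpairsPdep/andP => [[F' [j' []]]|[subF ltj]].
  by rewrite mem_enum mem_iota powersetE => /= subF ltj [-> ->].
by exists F, j; rewrite mem_enum mem_iota powersetE.
Qed.

Section Duality.
Variable S' : finType.
Implicit Types (nu : S' -> {set S}) (nuc : S' -> {set R}).

(** At a pair, this is the contrapositive of [hall_pair_sat]: a set [F] violating one of its two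
    conditions selects the disjunct to satisfy. *)
Lemma dual_sat phi nu nuc :
  ~ marking_sat nu phi ->
  (forall d F, [disjoint F & nu d] -> tgt F \in nuc d) ->
  marking_sat nuc (dual_constraint phi).
Proof.
move=> + nucP; elim: phi => //= [E U nsat|phi1 IH1 phi2 IH2|phi1 IH1 phi2 IH2].
- have nuc0 d : tgt set0 \in nuc d by apply: nucP; rewrite -setI_eq0 set0I.
  have [hallE|/existsNP[F /not_implyP[subF /negP]]] := pselect
      (forall F, F \subset msupp E ->
         msum E F <= #|[set d | ~~ [disjoint F & nu d]]|); last first.
    rewrite -ltnNge => lt_F; left; apply/marking_sat_ors.
    exists (F, #|[set d | ~~ [disjoint F & nu d]]|); rewrite ?few_rangeP ?subF //.
    by apply: two_state_sat => // d; rewrite inE negbK; apply: nucP.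
  have [hallU|/existsNP[F /not_implyP[subF /negP]]] := pselect
      (forall F, F \subset msupp E ->
         #|[set d | [disjoint U :|: F & nu d]]| <= msum E (~: F)).
    by case: nsat; apply: (hall_pair_sat hallE hallU).
  rewrite -ltnNge => /card_geqP[s [uniq_s sz_s sub_s]]; right.
  apply/marking_sat_ors; exists F; first by rewrite mem_enum powersetE.
  rewrite /dual_many -sz_s -(card_uniqP uniq_s) -cardsE.
  by apply: two_state_sat => // d; rewrite inE => /sub_s; rewrite inE; apply: nucP.
- by case/not_andP=> [/IH1|/IH2]; [left|right].
- by case/not_orP=> /IH1 sat1 /IH2.
Qed.

(** The easy direction of Hall's theorem, by pigeonhole. The clash at [d] is what later prolongs two
    runs followed in parallel. *)
Lemma dual_sat_conflict phi nu nuc :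
  marking_sat nu phi -> marking_sat nuc (dual_constraint phi) ->
  exists d F s, [/\ F \in targets phi, s \in F, s \in nu d & tgt F \in nuc d].
Proof.
rewrite /targets; elim: phi => //=; last first.
- move=> phi1 IH1 phi2 IH2 [/IH1{}IH|/IH2{}IH] [] => [/IH + _|_ /IH];
    move=> [d [F [s [tF Fs nus nucF]]]];
    by exists d, F, s; rewrite map_cat flatten_cat mem_cat tF ?orbT.
- move=> phi1 IH1 phi2 IH2 [/IH1{}IH1 /IH2{}IH2] [/IH1|/IH2] [d [F [s [tF Fs nus nucF]]]];
    by exists d, F, s; rewrite map_cat flatten_cat mem_cat tF ?orbT.
move=> E U [f nuf /mset_satP satf]; rewrite cats0.
case=> /marking_sat_ors => [[[F j]]|[F]].
  rewrite few_rangeP /= => /andP[subF ltj] [g nug /mset_satP satg].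
  (* [f] sends at least [msum E F] successors into [F], whereas [g] sends at most [j] of them
     elsewhere than to [tgt F]. *)
  have [d fFd gd] : exists2 d, f d \in F & g d = tgt F.
    apply: contrapT => noF; suff: msum E F <= j by rewrite leqNgt ltj.
    apply: leq_trans (_ : \sum_(s in F) image_mset f s <= _).
      by apply: leq_sum => s _; case: (satf s).
    rewrite sum_image_mset.
    apply: leq_trans (_ : #|[set d | g d \in ~: [set tgt F]]| <= _).
      apply/subset_leq_card/subsetP=> d; rewrite !inE => fFd.
      by apply/eqP=> gd; apply: noF; exists d.
    rewrite -sum_image_mset.
    apply: leq_trans (_ : \sum_(s in ~: [set tgt F]) msetn j (tgt set0) s <= _).
      by apply: leq_sum => s; rewrite inE; case: (satg s) => _ /[apply].
    rewrite big_mkcond (bigD1 (tgt set0)) //= big1 ?addn0.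
      by case: ifP; rewrite // msetnxx.
    by move=> s /negPf neq; rewrite msetnE neq; case: ifP.
  exists d, F, (f d); split; rewrite // -?gd //.
  rewrite mem_cat mem_filter mem_enum powersetE subF andbT.
  by apply/orP; left; apply/set0Pn; exists (f d).
rewrite mem_enum powersetE => subF [g nug /mset_satP satg].
(* [g] sends more than [msum E (~: F)] successors to [tgt (U :|: F)], whereas [f] sends at most
   [msum E (~: F)] outside [U :|: F]. *)
have [d fUFd gd] : exists2 d, f d \in U :|: F & g d = tgt (U :|: F).
  apply: contrapT => noUF.
  have [+ _] := satg (tgt (U :|: F)); rewrite msetnxx ltnNge => /negP; apply.
  apply: leq_trans (_ : \sum_(s in ~: (U :|: F)) image_mset f s <= _).
    rewrite sum_image_mset image_msetE; apply/subset_leq_card/subsetP=> d.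
    rewrite !inE => /eqP gd; apply/negP => fd; apply: noUF; exists d => //.
    by rewrite inE.
  apply: leq_trans (_ : \sum_(s in ~: (U :|: F)) E s <= _).
    apply: leq_sum => s; rewrite !inE negb_or => /andP[notU _].
    by case: (satf s) => _ /(_ notU).
  rewrite /msum [leqRHS](bigID [in U]) /= [leqRHS]addnC; apply: leq_trans (leq_addr _ _).
  rewrite [leqRHS]big_mkcond [leqLHS]big_mkcond; apply: leq_sum => s _.
  by rewrite !inE negb_or; case: (s \in U); case: (s \in F).
exists d, (U :|: F), (f d); split; rewrite // -?gd //.
by rewrite mem_cat; apply/orP; right; apply: map_f; rewrite mem_enum powersetE.
Qed.

End Duality.
End DualConstraint.

(** * The complement automaton and its size *)

Section DualSize.
Variables (S R : finType) (tgt : {set S} -> R).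
Local Open Scope mset_scope.
Implicit Types (E : {mset S}) (U F : {set S}) (phi : eu_constraint S).

Lemma msum_le E F : msum E F <= \sum_s E s.
Proof. by rewrite /msum [leqRHS](bigID [in F]) leq_addr. Qed.

Lemma card_msupp E : #|msupp E| <= \sum_s E s.
Proof.
rewrite -sum1_card; apply: leq_trans (msum_le E (msupp E)).
by apply: leq_sum => s; rewrite inE in_mset.
Qed.

Lemma size_powerset (F : {set S}) : size (enum (powerset F)) = 2 ^ #|F|.
Proof. by rewrite -cardE card_powerset. Qed.

Lemma size_pair_targets (p : {mset S} * {set S}) e :
  \sum_s p.1 s <= e -> 0 < e -> size (pair_targets p) <= e * (1 + 2 ^ e).
Proof.
move=> le_e e_gt0; have le_s := leq_trans (card_msupp p.1) le_e.
have le_2s : 2 ^ #|msupp p.1| <= 2 ^ e by rewrite leq_exp2l.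
rewrite size_cat size_map size_powerset size_filter.
have := count_predC (pred1 set0) (enum (powerset (msupp p.1))).
rewrite size_powerset count_uniq_mem ?enum_uniq // mem_enum powersetE sub0set.
rewrite (eq_count (a2 := fun F => F != set0)) //= => eq_s.
(* For [e > 1], [2 * 2 ^ e] is below the bound; for [e = 1] the bound is 3, reached thanks to the
   omitted empty set. *)
case: (ltnP 1 e) => [|le1]; first by nia.
have De : e = 1 by lia.
by move: eq_s le_2s; rewrite De expn1; lia.
Qed.

Lemma size_few_range E : size (few_range E) <= 2 ^ #|msupp E| * \sum_s E s.
Proof.
rewrite size_allpairs_dep -size_powerset; elim: (enum _) => //= F r IHr.
by rewrite size_iota mulSn leq_add ?msum_le.
Qed.

(** Each atom costs 2 with its connective: at most [2 ^ e * e] come from [dual_few] and [2 ^ e] from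
    [dual_many]. The two final [EUbot] and the outer [EUor] give the 3. *)
Lemma eu_size_dual_pair E U e :
  \sum_s E s <= e -> eu_size (dual_pair tgt E U) <= 2 * 2 ^ e * e.+1 + 3.
Proof.
move=> le_e; have le_s := leq_trans (card_msupp E) le_e.
have le_2s : 2 ^ #|msupp E| <= 2 ^ e by rewrite leq_exp2l.
have le_few : eu_size (EUors [seq dual_few tgt E x.1 x.2 | x <- few_range E])
    <= size (few_range E) * 2 + 1 by apply: eu_size_fold.
have le_many : eu_size (EUors [seq dual_many tgt E U F | F <- enum (powerset (msupp E))])
    <= 2 ^ #|msupp E| * 2 + 1 by rewrite -size_powerset; apply: eu_size_fold.
have le_range := leq_trans (size_few_range E) (leq_mul le_2s le_e).
by rewrite /= in le_few le_many *; nia.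
Qed.

Lemma eu_size_dual phi e :
  (forall p, p \in eu_pairs phi -> \sum_s p.1 s <= e) ->
  eu_size (dual_constraint tgt phi) <= eu_size phi * (2 * 2 ^ e * e.+1 + 3).
Proof.
pose K := 2 * 2 ^ e * e.+1 + 3; rewrite -/K.
elim: phi => [||E U|phi1 IH1 phi2 IH2|phi1 IH1 phi2 IH2] le_e; try by rewrite /K /=; lia.
- by rewrite mul1n; apply/eu_size_dual_pair/(le_e (E, U)); rewrite mem_head.
all: have {}IH1 : eu_size (dual_constraint tgt phi1) <= eu_size phi1 * K
  by [apply: IH1 => p pP; apply: le_e; rewrite /= mem_cat pP].
all: have {}IH2 : eu_size (dual_constraint tgt phi2) <= eu_size phi2 * K
  by [apply: IH2 => p pP; apply: le_e; rewrite /= mem_cat pP orbT].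
all: by rewrite /= mulSn mulnDl /K; rewrite /K in IH1 IH2; lia.
Qed.

Lemma eu_pairs_dual_pair E U p :
  p \in eu_pairs (dual_pair tgt E U) ->
  \sum_r p.1 r <= (\sum_s E s).+1 /\ #|p.2| = 1.
Proof.
have sum_msetn n (r0 : R) : \sum_r (msetn n r0) r = n.
  rewrite (bigD1 r0) //= msetnxx big1 ?addn0 // => r /negPf neq.
  by rewrite msetnE neq.
rewrite -[eu_pairs _]/(eu_pairs (EUors _) ++ eu_pairs (EUors _)) mem_cat.
case/orP; rewrite /EUors eu_pairs_fold // -map_comp.
  case/flattenP=> ps /mapP[[F j]]; rewrite few_rangeP => /andP[_ ltj] -> /=.
  rewrite inE => /eqP-> /=; rewrite sum_msetn cards1; split=> //.
  by rewrite (leq_trans (ltnW ltj)) // (leq_trans (msum_le _ _)).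
case/flattenP=> ps /mapP[F _ ->] /=; rewrite inE => /eqP-> /=.
by rewrite sum_msetn cards1 ltnS msum_le.
Qed.

Lemma eu_pairs_dual phi p :
  p \in eu_pairs (dual_constraint tgt phi) ->
  exists2 p0, p0 \in eu_pairs phi & p \in eu_pairs (dual_pair tgt p0.1 p0.2).
Proof.
elim: phi => //= [E U pP|phi1 IH1 phi2 IH2|phi1 IH1 phi2 IH2].
- by exists (E, U); rewrite ?mem_head.
all: rewrite mem_cat => /orP[/IH1|/IH2] [p0 p0P pP].
all: by exists p0; rewrite // mem_cat p0P ?orbT.
Qed.
End DualSize.

(** * States, transitions and size of the complement *)

Section Complement.
Variables (Sigma : finType) (A : aapta Sigma).
Local Open Scope mset_scope.
Let Q := state A.

(** [set0] claims nothing, [[set q]] provides the initial state, and the other sets are those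
    asserted by the duals of the transitions from [q]. *)
Definition state_targets (q : Q) : seq {set Q} :=
  set0 :: [set q] :: flatten [seq targets (delta q a) | a <- enum Sigma].

Definition cstate : finType :=
  {p : Q * {set Q} | p.2 \in state_targets p.1}.

Definition cstate0 (q : Q) : cstate :=
  exist (fun p : Q * {set Q} => p.2 \in state_targets p.1) (q, set0) (mem_head _ _).

(** A set outside [state_targets q] is replaced by [set0], a weaker claim, so that [val_mkstate_sub]
    holds for every [F]. *)
Definition mkstate (q : Q) (F : {set Q}) : cstate := insubd (cstate0 q) (q, F).

Lemma val_mkstate q F : F \in state_targets q -> val (mkstate q F) = (q, F).
Proof. by move=> Ft; rewrite /mkstate insubdK. Qed.

Lemma val_mkstate_sub q F :
  (val (mkstate q F)).1 = q /\ (val (mkstate q F)).2 \subset F.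
Proof.
by rewrite /mkstate val_insubd; case: ifP => _; rewrite /= ?subxx ?sub0set.
Qed.

Lemma targets_state q a F : F \in targets (delta q a) -> F \in state_targets q.
Proof.
move=> tF; rewrite !inE; apply/orP; right; apply/orP; right.
apply/flattenP; exists (targets (delta q a)) => //.
by apply/mapP; exists a; rewrite ?mem_enum.
Qed.

Definition cdelta (p : cstate) (a : Sigma) : eu_constraint cstate :=
  EUands [seq dual_constraint (mkstate g) (delta g a) | g <- enum (val p).2].

(* The state [(q, G)] stands for the conjunction of the states of [G]; as these
   have different priorities, it carries the priority of [q], the state visited
   one step before, whose satisfaction required [G]. *)
Definition complement : aapta Sigma :=
  AAPTA (mkstate (init A) [set init A]) cdelta
        (fun p => (priority A (val p).1).+1).

Let B := size_deltaB A.
Let E := size_deltaE A.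
Let E1 := maxn E 1.

Lemma eu_size_delta (q : Q) a : eu_size (delta q a) <= B.
Proof. by apply: (bigmax_sup q) => //; apply: (bigmax_sup a). Qed.

Lemma sum_delta (q : Q) a p : p \in eu_pairs (delta q a) -> \sum_s p.1 s <= E.
Proof.
move=> pP; apply: (bigmax_sup q) => //; apply: (bigmax_sup a) => //.
exact: (@leq_bigmax_seq _ _ xpredT (fun p : {mset Q} * {set Q} => \sum_s p.1 s) p).
Qed.

Lemma size_state_complement :
  size_state complement <= size_state A * (2 + #|Sigma| * B * E1 * (1 + 2 ^ E1)).
Proof.
apply: leq_trans (_ : \sum_(q : Q) \sum_(F | F \in state_targets q) 1 <= _).
  by rewrite pair_big_dep /size_state /= card_sig -sum1_card; apply/eq_leq/eq_bigl.
rewrite -sum_nat_const; apply: leq_sum => q _; rewrite sum1_card.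
apply: leq_trans (card_size _) _; rewrite /= !ltnS size_flatten /shape -map_comp.
rewrite sumnE big_map -!mulnA cardE -sum1_size big_distrl /=.
rewrite big_enum /= [leqRHS]big_enum /=.
apply: leq_sum => a _; rewrite mul1n size_flatten /shape -map_comp sumnE big_map.
apply: leq_trans (_ : size (eu_pairs (delta q a)) * (E1 * (1 + 2 ^ E1)) <= _).
  rewrite -sum1_size big_distrl /= big_seq [leqRHS]big_seq; apply: leq_sum => p pP.
  by rewrite mul1n size_pair_targets ?leq_maxr // leq_max (sum_delta pP).
by rewrite leq_mul2r (leq_trans (size_eu_pairs _)) ?eu_size_delta ?orbT.
Qed.

(** A transition conjoins at most [size_state A] duals of size at most [B * K]; as [B > 0], the
    connectives and the final [EUtop] are absorbed by [(1 + size_state A) * (B * K.+1)]. *)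
Lemma size_deltaB_complement :
  size_deltaB complement <= 4 * (1 + size_state A) * B * E1 ^ 3 * 4 ^ E1.
Proof.
apply/bigmax_leqP => x _; apply/bigmax_leqP => a _.
pose K := 2 * 2 ^ E1 * E1.+1 + 3.
have le_dual (g : Q) : eu_size (dual_constraint (mkstate g) (delta g a)) <= B * K.
  apply: leq_trans (eu_size_dual (e := E1) _ _) _ => [p /sum_delta le_p|].
    by rewrite leq_max le_p.
  by rewrite leq_mul2r eu_size_delta orbT.
have := eu_size_fold (op := @EUand cstate) (e := EUtop) (enum (val x).2)
  (fun _ _ => erefl) erefl le_dual.
have B_gt0 : 0 < B.
  by apply: leq_trans (eu_size_delta (init A) a); case: (delta _ _).
have leQ : size (enum (val x).2) <= size_state A by rewrite -cardE max_card.
have E1_gt0 : 0 < E1 by rewrite leq_maxr.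
have -> : 4 ^ E1 = 2 ^ E1 * 2 ^ E1 by rewrite -expnMn.
have : 2 <= 2 ^ E1 by rewrite -{1}(expn1 2) leq_exp2l.
rewrite /= -/(EUands _) -/(cdelta _ _) /K.
move: (2 ^ E1) (size (enum _)) (size_state A) leQ => P n q le_nq le2P.
have -> : E1 ^ 3 = E1 * E1 * E1 by rewrite !expnS expn0 muln1 mulnA.
move: E1 B E1_gt0 B_gt0 => e b e_gt0 b_gt0 le_size.
apply: (leq_trans le_size).
have leK : (2 * P * e.+1 + 3).+1 <= 4 * (e * e * e) * (P * P).
  apply: leq_trans (_ : 4 * e * (P * P) <= _); last by rewrite leq_mul2r leq_mul2l; nia.
  nia.
apply: leq_trans (_ : (1 + q) * (b * (2 * P * e.+1 + 3).+1) <= _).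
  move: (2 * P * e.+1 + 3) => k; nia.
apply: leq_trans (_ : (1 + q) * (b * (4 * (e * e * e) * (P * P))) <= _); last by lia.
by rewrite !leq_mul2l leK !orbT.
Qed.

Lemma eu_pairs_cdelta x a p :
  p \in eu_pairs (cdelta x a) -> \sum_r p.1 r <= E + 1 /\ #|p.2| = 1.
Proof.
rewrite /cdelta /EUands eu_pairs_fold // -map_comp => /flattenP[ps /mapP[g _ ->]] /=.
case/eu_pairs_dual=> p0 /sum_delta le_E /eu_pairs_dual_pair[le_p ->].
by rewrite addn1 (leq_trans le_p).
Qed.

Lemma size_deltaE_complement : size_deltaE complement <= E + 1.
Proof.
apply/bigmax_leqP => x _; apply/bigmax_leqP => a _; apply/bigmax_leqP_seq => p pP _.
by case: (eu_pairs_cdelta pP).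
Qed.

Lemma size_deltaU_complement : size_deltaU complement <= 1.
Proof.
apply/bigmax_leqP => x _; apply/bigmax_leqP => a _; apply/bigmax_leqP_seq => p pP _.
by case: (eu_pairs_cdelta pP) => _ ->.
Qed.

Lemma size_priority_complement : size_priority complement <= size_priority A.
Proof.
rewrite /size_priority -(size_map succn (undup (codom (priority A)))).
apply: uniq_leq_size (undup_uniq _) _ => n; rewrite mem_undup => /codomP[x ->].
by apply: map_f; rewrite mem_undup codom_f.
Qed.

End Complement.

(** * Correctness *)

Section StepTree.
Variables (C : finType) (R : seq C -> C -> Prop).

Definition step_tree : pred (seq C) :=
  fun x => `[< forall y a, prefix (rcons y a) x -> R y a >].

Lemma step_tree_is_tree : is_tree step_tree.
Proof.
split=> [|m n mn /asboolP Rn]; apply/asboolP=> y a.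
  by rewrite prefixs0; case: y.
by move=> /prefix_trans/(_ mn)/Rn.
Qed.

Lemma step_tree_rcons x a : step_tree (rcons x a) <-> step_tree x /\ R x a.
Proof.
split=> [/asboolP Rx|[/asboolP Rx Rxa]].
  split; last by apply: Rx; apply: prefix_refl.
  by apply/asboolP=> y c yx; apply: Rx; apply: prefix_trans yx (prefix_rcons _ _).
apply/asboolP=> y c /prefixP[z]; case/lastP: z => [|z d].
  by rewrite cats0 => /rcons_inj[<- <-].
rewrite -rcons_cat => /rcons_inj[Dx _]; apply: Rx; apply/prefixP.
by exists z.
Qed.

Lemma step_tree_branch (b : nat -> C) :
  (forall n, step_tree (mkseq b n)) -> forall n, R (mkseq b n) (b n).
Proof. by move=> tb n; have := tb n.+1; rewrite mkseqS step_tree_rcons => -[]. Qed.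

End StepTree.

Lemma acceptingP (Sigma : finType) (A : aapta Sigma) (T : ltree Sigma)
    (e : pred (seq (dir T * state A))) :
  accepting e <->
  forall b, infinite_branch e b ->
    limit_parity (fun n => priority A (exec_state (mkseq b n))) false.
Proof.
by split=> acc b /acc[p [? ? odd_p]]; exists p; split=> //; move: odd_p; case: odd.
Qed.

(** * Strategies in the acceptance game and execution trees *)

Section Runs.
Variables (Sigma : finType) (A : aapta Sigma) (T : ltree Sigma).
Let D := dir T.
Let Q := state A.

Lemma exec_pos_rcons (P : finType) (x : seq (D * P)) a :
  unzip1 (rcons x a) = rcons (unzip1 x) a.1.
Proof. exact: map_rcons. Qed.

Lemma exec_state_rcons (x : seq (D * Q)) a : exec_state (rcons x a) = a.2.
Proof. by rewrite /exec_state /unzip2 map_rcons last_rcons. Qed.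

(** The acceptance game, with a node and a state as position. Constraints are monotone in the
    marking, so the largest marking allowed by [P] decides. *)
Definition force (x : seq D * Q) (P : seq D * Q -> Prop) : Prop :=
  marking_sat (fun d : @successor _ T x.1 =>
                 [set q | `[< P (rcons x.1 (val d), q) >]])
              (delta x.2 (label T x.1)).

Let pos (x : seq (D * Q)) : seq D * Q := (exec_pos x, exec_state x).
Let prio (x : seq D * Q) : nat := priority A x.2.

(** The execution tree consists of all plays along [S]. *)
Lemma strategy_accepts Y W S :
  good_strategy prio force false 0 Y W S -> W ([::], init A) -> accepts A T.
Proof.
move=> [forceS stepS pathS] W0.
pose R (x : seq (D * Q)) a :=
  node T (exec_pos (rcons x a)) /\ S (pos x) (pos (rcons x a)).
have WR x : step_tree R x -> W (pos x).
  elim/last_ind: x => // x a IHx /step_tree_rcons[/IHx Wx [_ Sx]].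
  exact: stepS Wx Sx.
exists (step_tree R).
  split; first exact: step_tree_is_tree.
    case/lastP=> [_|x a /step_tree_rcons[_ []] //]; by case: (node_tree T).
  move=> x tx; apply: marking_sat_mono (forceS _ (WR x tx)) => d.
  apply/subsetP=> q; rewrite !inE => /asboolP Sx; apply/step_tree_rcons.
  split; rewrite // /R /pos exec_state_rcons /exec_pos exec_pos_rcons; split=> //.
  exact: valP d.
apply/acceptingP=> b tb; apply: (pathS (fun n => pos (mkseq b n))) => // n.
by have [] := step_tree_branch tb n; rewrite -mkseqS.
Qed.

Let Ac := complement A.

Lemma dual_strategy_accepts Y W S :
  good_strategy prio (dual force) true 0 Y W S -> W ([::], init A) ->
  accepts Ac T.
Proof.
move=> [forceS stepS pathS] W0.
pose R (x : seq (D * state Ac)) (a : D * state Ac) :=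
  [/\ node T (exec_pos (rcons x a)),
      (val a.2).1 \in (val (exec_state x)).2
    & forall h, h \in (val a.2).2 ->
        S (exec_pos x, (val a.2).1) (exec_pos (rcons x a), h)].
have stateS (x : seq (D * state Ac)) a : exec_state (rcons x a) = a.2.
  by rewrite /exec_state /unzip2 map_rcons last_rcons.
have init_Ac : val (init Ac) = (init A, [set init A]).
  by apply: val_mkstate; rewrite !inE eqxx orbT.
have WR x : step_tree R x ->
    forall g, g \in (val (exec_state x)).2 -> W (exec_pos x, g).
  elim/last_ind: x => [_ g|x a IHx /step_tree_rcons[/IHx Wx [_ Gx Sx]] g].
    by rewrite /exec_state /= init_Ac inE => /eqP->.
  by rewrite stateS => /Sx; apply: stepS; apply: Wx.
exists (step_tree R).
  split; first exact: step_tree_is_tree.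
    case/lastP=> [_|x a /step_tree_rcons[_ []] //]; by case: (node_tree T).
  move=> x tx; apply/marking_sat_ands => g; rewrite mem_enum => Gg.
  apply: dual_sat (forceS _ (WR x tx g Gg)) _ => d F; rewrite disjoint_subset => disF.
  have [Dg subF] := val_mkstate_sub g F.
  rewrite inE; apply/step_tree_rcons; split=> //.
  rewrite /R Dg /exec_pos exec_pos_rcons; split=> // [|h hF].
    exact: valP d.
  have := subsetP disF h (subsetP subF h hF); rewrite !inE => /asboolPn.
  by rewrite notK.
apply/acceptingP=> b tb; have stepb := step_tree_branch tb.
(* The components [q] along a branch form a play along [S], one step behind the states that carry
   them; hence the shift by 1. *)
have [_ G0 _] := stepb 0; have pathb n : S (exec_pos (mkseq b n), (val (b n).2).1)
    (exec_pos (mkseq b n.+1), (val (b n.+1).2).1).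
  have [_ _ Sn] := stepb n; have [_ Gn _] := stepb n.+1.
  by rewrite mkseqS; apply: Sn; rewrite mkseqS stateS in Gn.
apply/(limit_parity_shift 1).
rewrite (_ : (fun n => _) = (fun n => (priority A (val (b n).2).1).+1)); last first.
  by apply/funext=> n; rewrite add1n mkseqS stateS.
apply/limit_parity_succ.
apply: (pathS (fun n => (exec_pos (mkseq b n), (val (b n).2).1))) => //=.
by move: G0; rewrite /exec_state /= init_Ac inE => /eqP->.
Qed.

Lemma conflict_step (e : pred (seq (D * Q))) (ec : pred (seq (D * state Ac))) x y :
  execution_tree e -> execution_tree ec -> e x -> ec y ->
  exec_pos x = exec_pos y -> exec_state x \in (val (exec_state y)).2 ->
  exists d q r, [/\ e (rcons x (d, q)), ec (rcons y (d, r)),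
    q \in (val r).2 & (val r).1 = exec_state x].
Proof.
move=> [_ _ sat_e] [_ _ sat_ec] ex ecy eq_pos Gx.
have sat_x := sat_e x ex; have := sat_ec y ecy; rewrite /exec_marking -eq_pos.
move=> /marking_sat_ands/(_ (exec_state x)); rewrite mem_enum => /(_ Gx) sat_y.
have [d [F [q [tF Fq]]]] := dual_sat_conflict sat_x sat_y.
have Dr := val_mkstate (targets_state tF).
by rewrite !inE => exq ecr; exists (val d), q, (mkstate (exec_state x) F); rewrite Dr.
Qed.

(** Two accepting runs are followed in parallel, keeping the state of [A] in the set claimed by
    [Ac]. The resulting branches have the same priorities up to a delay of one step and an
    increment, so the parities of their limits differ. *)
Lemma accepts_disjoint : accepts Ac T -> accepts A T -> False.
Proof.
move=> [ec tree_ec /acceptingP acc_ec] [e tree_e /acceptingP acc_e].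
pose inv (xy : seq (D * Q) * seq (D * state Ac)) :=
  [/\ e xy.1, ec xy.2, exec_pos xy.1 = exec_pos xy.2
    & exec_state xy.1 \in (val (exec_state xy.2)).2].
pose next (xy : seq (D * Q) * seq (D * state Ac)) (m : D * Q * state Ac) :=
  (rcons xy.1 m.1, rcons xy.2 (m.1.1, m.2)).
have step (s : {xy | inv xy}) : exists m,
    inv (next (sval s) m) /\ (val m.2).1 = exec_state (sval s).1.
  case: s => xy [ex ecy eq_pos Gx] /=.
  have [d [q [r [exq ecr Fq Dr]]]] := conflict_step tree_e tree_ec ex ecy eq_pos Gx.
  exists (d, q, r); rewrite /inv /= /exec_pos !exec_pos_rcons /= exec_state_rcons.
  rewrite /exec_pos in eq_pos.
  by rewrite /exec_state /unzip2 map_rcons last_rcons eq_pos.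
have [move_ moveP] := choice step.
have inv0 : inv ([::], [::]).
  split=> //; [by case: tree_e => -[] | by case: tree_ec => -[] |].
  rewrite /exec_state /= val_mkstate; first exact: set11.
  by rewrite inE mem_head orbT.
pose st := fix st n : {xy | inv xy} :=
  if n is n'.+1 then exist inv _ (proj1 (moveP (st n'))) else exist inv _ inv0.
pose b n := (move_ (st n)).1.
pose bc n := ((move_ (st n)).1.1, (move_ (st n)).2).
have Dst n : sval (st n) = (mkseq b n, mkseq bc n).
  by elim: n => // n IHn; rewrite !mkseqS /= IHn.
have win : limit_parity (fun n => priority A (exec_state (mkseq b n))) false.
  by apply: acc_e => n; have [] := svalP (st n); rewrite Dst.
have : limit_parity (fun n => priority Ac (exec_state (mkseq bc (1 + n)))) false.
  apply/(limit_parity_shift 1 (fun n => priority Ac (exec_state (mkseq bc n)))).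
  by apply: acc_ec => n; have [] := svalP (st n); rewrite Dst.
rewrite (_ : (fun n => _) = (fun n => (priority A (exec_state (mkseq b n))).+1)).
  by move/limit_parity_succ/(limit_parity_inj win).
apply/funext=> n; rewrite add1n mkseqS /exec_state /unzip2 map_rcons last_rcons /=.
by have [_ ->] := moveP (st n); rewrite Dst.
Qed.

Lemma complement_accepts : accepts Ac T <-> ~ accepts A T.
Proof.
split=> [accAc accA|nacc]; first exact: accepts_disjoint.
have lt_prio x : prio x < (\max_q priority A q).+1.
  by rewrite ltnS; apply: leq_bigmax.
have [W [S [[gS W0]|[gS W0]]]] := determinacy force ([::], init A) lt_prio.
  by case: nacc; apply: strategy_accepts gS W0.
exact: dual_strategy_accepts gS W0.
Qed.

End Runs.

Theorem theorem3 (Sigma : finType) (A : aapta Sigma) :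
  let Q := size_state A in
  let B := size_deltaB A in
  let E := size_deltaE A in
  let U := size_deltaU A in
  let W := size_priority A in
  let E1 := maxn E 1 in
  exists Ac : aapta Sigma,
    (forall T : ltree Sigma, accepts Ac T <-> ~ accepts A T) /\
    [/\ size_state Ac <= 1 + Q * (2 + #|Sigma| * B * E1 * (1 + 2 ^ E1)),
        size_deltaB Ac <= 4 * (1 + Q) * B * E1 ^ 3 * 4 ^ E1,
        size_deltaE Ac <= E + 1,
        size_deltaU Ac <= maxn U 1
      & size_priority Ac <= W + 1].
Proof.
exists (complement A); split=> [T|]; first exact: complement_accepts.
split.
- by rewrite (leq_trans (size_state_complement A)) ?leq_addl.
- exact: size_deltaB_complement.
- exact: size_deltaE_complement.
- by rewrite (leq_trans (size_deltaU_complement A)) ?leq_maxr.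
- by rewrite (leq_trans (size_priority_complement A)) ?leq_addr.
Qed.
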